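(* Strong confluence is not first-order definable: the properties $\mathrm{SC}$ and $\neg\mathrm{SC}$ of abstract rewrite systems are not generalised first-order properties.
   Context: An ARS is a pair $(A,\to)$, $A$ non-empty, ${\to}\subseteq A\times A$; $\twoheadrightarrow$ is the reflexive transitive closure and $\to^{\equiv}$ is $\to$ union identity. SC (strong confluence): whenever $a\to x$ and $a\to y$, there is $z$ with $x\to^{\equiv}z$ and $y\twoheadrightarrow z$. $\neg\mathrm{SC}$ is the property of not being strongly confluent. A property $P$ is a generalised first-order property if there is a set $\Phi$ of sentences of first-order logic with equality and a binary predicate symbol $\to$ (interpreted as the one-step relation) such that for every ARS $\mathcal{A}$, $\mathcal{A}$ has $P$ iff $\mathcal{A}\models\Phi$. *)

(* Defs.v *)
From Stdlib Require Import Arith Relations.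

Record ars : Type := Ars {
  carrier :> Type;
  step : relation carrier;
  carrier_nonempty : inhabited carrier
}.

Arguments step {a} _ _.

Definition strongly_confluent (A : ars) : Prop :=
  forall a x y : A, step a x -> step a y ->
    exists z : A, clos_refl A step x z /\ clos_refl_trans A step y z.

(** Variables are named by natural numbers. *)
Inductive formula : Type :=
| Falsum : formula
| Equal (x y : nat) : formula
| Step (x y : nat) : formula
| Not (phi : formula) : formula
| And (phi psi : formula) : formula
| Or (phi psi : formula) : formula
| Imp (phi psi : formula) : formula
| Forall (x : nat) (phi : formula) : formula
| Exists (x : nat) (phi : formula) : formula.

Fixpoint free_in (v : nat) (phi : formula) : Prop :=
  match phi with
  | Falsum => False
  | Equal x y | Step x y => v = x \/ v = y
  | Not phi => free_in v phi
  | And phi psi | Or phi psi | Imp phi psi => free_in v phi \/ free_in v psi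
  | Forall x phi | Exists x phi => v <> x /\ free_in v phi
  end.

Record sentence : Type := Sentence {
  sentence_formula :> formula;
  sentence_closed : forall v : nat, ~ free_in v sentence_formula
}.

Definition update {T : Type} (rho : nat -> T) (x : nat) (t : T) : nat -> T :=
  fun y => if Nat.eq_dec y x then t else rho y.

Fixpoint satisfies (A : ars) (rho : nat -> A) (phi : formula) : Prop :=
  match phi with
  | Falsum => False
  | Equal x y => rho x = rho y
  | Step x y => step (rho x) (rho y)
  | Not phi => ~ satisfies A rho phi
  | And phi psi => satisfies A rho phi /\ satisfies A rho psi
  | Or phi psi => satisfies A rho phi \/ satisfies A rho psi
  | Imp phi psi => satisfies A rho phi -> satisfies A rho psi
  | Forall x phi => forall a : A, satisfies A (update rho x a) phi
  | Exists x phi => exists a : A, satisfies A (update rho x a) phi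
  end.

(** Truth of a sentence does not depend on the assignment, and assignments
    exist because the carrier is non-empty. *)
Definition models (A : ars) (Phi : sentence -> Prop) : Prop :=
  forall phi : sentence, Phi phi ->
    forall rho : nat -> A, satisfies A rho phi.

Definition generalised_first_order (P : ars -> Prop) : Prop :=
  exists Phi : sentence -> Prop, forall A : ars, P A <-> models A Phi.

(* Main.v *)
(** An ARS [A] that is strongly confluent and an elementarily equivalent ARS
    that is not refute both claims at once.  For [A] take a strongly connected
    ARS, which is strongly confluent because the two targets of a peak reduce to
    each other, but choose it so that for every [n] there is a peak whose
    targets cannot be joined in fewer than [n] steps.  In a non-principal
    ultrapower of [A], which is elementarily equivalent to [A] by Łoś's theorem,
    the sequence of these peaks is a peak whose targets have no common reduct
    of the required form. *)

From Stdlib Require Import Arith Relations Lia.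
From mathcomp Require ssrnat boolp classical_sets filter.
Require Import Defs.

(** * Ultrafilters and the logical connectives and quantifiers *)

Section Ultrafilter.

Context {I : Type} {U : (I -> Prop) -> Prop}.
Hypothesis U_ultra : filter.UltraFilter (T := I) U.

Let U_filter : filter.Filter U :=
  @filter.filter_filter _ _ (@filter.ultra_proper _ _ U_ultra).

Lemma ultra_mono (P Q : I -> Prop) : (forall i, P i -> Q i) -> U P -> U Q.
Proof. exact (@filter.filterS _ _ U_filter P Q). Qed.

Lemma ultra_iff (P Q : I -> Prop) : (forall i, P i <-> Q i) -> U P <-> U Q.
Proof. intros H; split; apply ultra_mono; intros i; apply H. Qed.

Lemma ultra_all (P : I -> Prop) : (forall i, P i) -> U P.
Proof.
  intros H. apply (ultra_mono (fun _ => True)); [auto|].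
  exact (@filter.filterT _ _ U_filter).
Qed.

Lemma ultra_and (P Q : I -> Prop) : U (fun i => P i /\ Q i) <-> U P /\ U Q.
Proof.
  split.
  - intros H; split; revert H; apply ultra_mono; tauto.
  - intros [HP HQ]. exact (@filter.filterI _ _ U_filter P Q HP HQ).
Qed.

Lemma ultra_False : ~ U (fun _ => False).
Proof.
  exact (@filter.filter_not_empty _ _ (@filter.ultra_proper _ _ U_ultra)).
Qed.

Lemma ultra_not (P : I -> Prop) : U (fun i => ~ P i) <-> ~ U P.
Proof.
  split.
  - intros HN HP. apply ultra_False.
    apply (ultra_mono (fun i => P i /\ ~ P i)); [tauto|].
    apply ultra_and; auto.
  - intros HN. destruct (filter.in_ultra_setVsetC P U_ultra); [tauto|assumption].
Qed.

Lemma ultra_imp (P Q : I -> Prop) : U (fun i => P i -> Q i) <-> (U P -> U Q).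
Proof.
  split.
  - intros H HP. apply (ultra_mono (fun i => (P i -> Q i) /\ P i)); [tauto|].
    apply ultra_and; auto.
  - intros H. destruct (boolp.EM (U P)) as [HP|HP].
    + apply (ultra_mono Q); auto.
    + apply (ultra_mono (fun i => ~ P i)); [tauto|]. now apply ultra_not.
Qed.

Lemma ultra_or (P Q : I -> Prop) : U (fun i => P i \/ Q i) <-> U P \/ U Q.
Proof.
  split.
  - intros H. destruct (boolp.EM (U P)) as [HP|HP]; [auto|right].
    apply ultra_not in HP.
    apply (ultra_mono (fun i => (P i \/ Q i) /\ ~ P i)); [tauto|].
    apply ultra_and; auto.
  - intros [H|H]; revert H; apply ultra_mono; auto.
Qed.

(** Choice collects the pointwise witnesses into one function, with the default [t0] at indices that
    have none. *)
Lemma ultra_exists {T : Type} (P : I -> T -> Prop) : inhabited T ->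
  U (fun i => exists t, P i t) <-> exists f : I -> T, U (fun i => P i (f i)).
Proof.
  intros [t0]. split.
  - intros H.
    assert (choose : forall i, exists t, (exists t, P i t) -> P i t).
    { intros i. destruct (boolp.EM (exists t, P i t)) as [[t Ht]|HN].
      - now exists t.
      - exists t0. tauto. }
    destruct (boolp.choice choose) as [f Hf].
    exists f. revert H. now apply ultra_mono.
  - intros [f H]. revert H. apply ultra_mono. eauto.
Qed.

(** Dual to [ultra_exists]: otherwise a function picking counterexamples would refute the right-hand
    side. *)
Lemma ultra_forall {T : Type} (P : I -> T -> Prop) : inhabited T ->
  U (fun i => forall t, P i t) <-> forall f : I -> T, U (fun i => P i (f i)).
Proof.
  intros HT. split.
  - intros H f. revert H. apply ultra_mono. auto.
  - intros H. apply boolp.contrapT. intros HN. apply ultra_not in HN.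
    assert (HE : U (fun i => exists t, ~ P i t)).
    { revert HN. apply ultra_mono. intros i. apply boolp.existsNP. }
    apply (ultra_exists _ HT) in HE. destruct HE as [f Hf].
    apply ultra_not in Hf. auto.
Qed.

(** * Ultrapowers and Łoś's theorem *)

Section Ultrapower.

Variable A : ars.

Definition agree (f g : I -> A) : Prop := U (fun i => f i = g i).

(** The quotient by [agree] is encoded as the type of its classes, so that [Equal] is interpreted by
    genuine equality. *)
Definition ultrapower_carrier : Type :=
  {c : (I -> A) -> Prop | exists f, c = agree f}.

Definition germ (f : I -> A) : ultrapower_carrier :=
  exist _ (agree f) (ex_intro _ f eq_refl).

Lemma germ_surj (c : ultrapower_carrier) : exists f, c = germ f.
Proof.
  destruct c as [c Hc]. pose proof Hc as [f Hf]. exists f.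
  apply boolp.eq_exist. exact Hf.
Qed.

Lemma germ_eq (f g : I -> A) : germ f = germ g <-> agree f g.
Proof.
  split.
  - intros H. apply (f_equal (@proj1_sig _ _)) in H. cbn in H.
    rewrite H. now apply ultra_all.
  - intros H. apply boolp.eq_exist. cbn. apply boolp.funext; intros h.
    apply boolp.propext. unfold agree in *.
    split; intros K; generalize (proj2 (ultra_and _ _) (conj H K));
      apply ultra_mono; intros i [E1 E2]; congruence.
Qed.

Definition ultrapower_step (c d : ultrapower_carrier) : Prop :=
  exists f g, c = germ f /\ d = germ g /\ U (fun i => step (f i) (g i)).

Lemma ultrapower_inhabited : inhabited ultrapower_carrier.
Proof. destruct (carrier_nonempty A) as [a]. exact (inhabits (germ (fun _ => a))). Qed.

Definition ultrapower : ars :=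
  Ars ultrapower_carrier ultrapower_step ultrapower_inhabited.

Lemma step_germ (f g : I -> A) :
  ultrapower_step (germ f) (germ g) <-> U (fun i => step (f i) (g i)).
Proof.
  split.
  - intros (f' & g' & Ef & Eg & H).
    apply germ_eq in Ef. apply germ_eq in Eg.
    generalize (proj2 (ultra_and _ _) (conj (proj2 (ultra_and _ _) (conj Ef Eg)) H)).
    apply ultra_mono. intros i [[E1 E2] K]. congruence.
  - intros H. exists f, g. auto.
Qed.

Lemma update_germ (rho : nat -> I -> A) (x : nat) (f : I -> A) :
  update (fun v => germ (rho v)) x (germ f) = fun v => germ (update rho x f v).
Proof.
  apply boolp.funext; intros v. unfold update. now destruct (Nat.eq_dec v x).
Qed.

Lemma update_eval (rho : nat -> I -> A) (x : nat) (f : I -> A) (i : I) :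
  (fun v => update rho x f v i) = update (fun v => rho v i) x (f i).
Proof.
  apply boolp.funext; intros v. unfold update. now destruct (Nat.eq_dec v x).
Qed.

(** Each connective and quantifier commutes with [U]. The assignment stays general because the
    quantifier cases update it. *)
Theorem los (phi : formula) : forall rho : nat -> I -> A,
  satisfies ultrapower (fun v => germ (rho v)) phi <->
  U (fun i => satisfies A (fun v => rho v i) phi).
Proof.
  induction phi as [|x y|x y|phi IH|phi IH1 psi IH2|phi IH1 psi IH2
                   |phi IH1 psi IH2|x phi IH|x phi IH]; intros rho; cbn [satisfies].
  - split; [tauto|apply ultra_False].
  - apply germ_eq.
  - apply step_germ.
  - rewrite ultra_not, IH. reflexivity.
  - rewrite ultra_and, IH1, IH2. reflexivity.
  - rewrite ultra_or, IH1, IH2. reflexivity.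
  - rewrite ultra_imp, IH1, IH2. reflexivity.
  - rewrite (ultra_forall (fun i a => satisfies A (update (fun v => rho v i) x a) phi)
      (carrier_nonempty A)).
    assert (E : forall f, satisfies ultrapower
                  (update (fun v => germ (rho v)) x (germ f)) phi <->
                U (fun i => satisfies A (update (fun v => rho v i) x (f i)) phi)).
    { intros f. rewrite update_germ, IH. apply ultra_iff; intros i.
      now rewrite update_eval. }
    split.
    + intros H f. apply E, H.
    + intros H c. destruct (germ_surj c) as [f ->]. apply E, H.
  - rewrite (ultra_exists (fun i a => satisfies A (update (fun v => rho v i) x a) phi)
      (carrier_nonempty A)).
    assert (E : forall f, satisfies ultrapower
                  (update (fun v => germ (rho v)) x (germ f)) phi <->
                U (fun i => satisfies A (update (fun v => rho v i) x (f i)) phi)).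
    { intros f. rewrite update_germ, IH. apply ultra_iff; intros i.
      now rewrite update_eval. }
    split.
    + intros [c H]. destruct (germ_surj c) as [f ->]. exists f. now apply E.
    + intros [f H]. exists (germ f). now apply E.
Qed.

Lemma models_ultrapower (Phi : sentence -> Prop) :
  models ultrapower Phi <-> models A Phi.
Proof.
  split; intros H phi Hphi rho.
  (* Under constant representatives, truth in [A] is the same at every index, so its failure would
     put the empty set into [U]. *)
  - specialize (H phi Hphi (fun v => germ (fun _ => rho v))).
    apply los in H. apply boolp.contrapT. intros HN. apply ultra_False.
    revert H. now apply ultra_mono.
  - destruct (boolp.choice (fun v => germ_surj (rho v))) as [r Hr].
    rewrite (boolp.funext Hr).
    apply los, ultra_all. auto.
Qed.

End Ultrapower.
End Ultrafilter.

Arguments ultrapower {I} U A.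
Arguments germ {I} U {A} f.

Lemma free_ultrafilter_nat : exists U : (nat -> Prop) -> Prop,
  filter.UltraFilter (T := nat) U /\ forall N, U (fun n => N <= n).
Proof.
  destruct (filter.ultraFilterLemma filter.eventually_filter) as [U [HU Hle]].
  exists U. split; [exact HU|]. intros N. apply Hle.
  exists N; [exact Logic.I|]. intros n Hn. exact (ssrbool.elimT ssrnat.leP Hn).
Qed.

(** * The strongly connected ARS of rays *)

Lemma strongly_connected_sc (A : ars) :
  (forall x y : A, clos_refl_trans A step x y) -> strongly_confluent A.
Proof. intros H a x y _ _. exists x. split; [apply r_refl|apply H]. Qed.

(** Row [n] is an infinite ray that can be left, towards the start of any row,
    only from position [0] or from a position at least [n]. *)
Definition ray_step (p q : nat * nat) : Prop :=
  (fst q = fst p /\ snd q = S (snd p)) \/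
  ((snd p = 0 \/ fst p <= snd p) /\ snd q = 0).

Definition rays : ars := Ars (nat * nat) ray_step (inhabits (0, 0)).

Lemma ray_climb (n i k : nat) : clos_refl_trans rays step (n, i) (n, k + i).
Proof.
  induction k as [|k IH]; [apply rt_refl|].
  apply rt_trans with (n, k + i); [exact IH|]. apply rt_step. now left.
Qed.

Lemma rays_sc : strongly_confluent rays.
Proof.
  apply strongly_connected_sc. intros [n i] [m j].
  (* Position [n + i] is at least [n], so row [n] can be left there. *)
  apply rt_trans with (n, n + i); [apply ray_climb|].
  apply rt_trans with (m, 0).
  - apply rt_step. right. cbn. lia.
  - rewrite <- (Nat.add_0_r j). apply ray_climb.
Qed.

(** * A peak without the required join in the ultrapower *)

Section FreeUltrapower.

Context {U : (nat -> Prop) -> Prop}.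
Hypothesis U_ultra : filter.UltraFilter (T := nat) U.
Hypothesis U_free : forall N, U (fun n => N <= n).

Let B : ars := ultrapower U rays.

(** Position [i] of a row with infinite index: its second exit lies beyond every standard
    position. *)
Let node (i : nat) : B := germ U (A := rays) (fun n => (n, i)).

Let origin : B := germ U (A := rays) (fun _ => (0, 0)).

Lemma reduct_of_node (i : nat) (c : B) :
  clos_refl_trans B step (node (S i)) c -> exists k, c = node (S k).
Proof.
  intros H. apply clos_rt_rtn1 in H.
  induction H as [|c d Hcd _ [k ->]]; [now exists i|].
  exists (S k). destruct (germ_surj rays d) as [g ->].
  apply (step_germ U_ultra) in Hcd. apply (germ_eq U_ultra).
  (* From the positive position [S k], leaving row [n] needs [n <= S k]; for larger [n] only the
     climb remains. *)
  generalize (proj2 (ultra_and U_ultra _ _) (conj Hcd (U_free (S (S k))))).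
  apply (ultra_mono U_ultra). intros n [Hs Hn].
  destruct (g n) as [m j]. unfold step, rays, ray_step in Hs. cbn in Hs.
  f_equal; lia.
Qed.

Lemma ultrapower_rays_not_sc : ~ strongly_confluent B.
Proof.
  intros H. destruct (H (node 0) origin (node 1)) as [z [Hx Hy]].
  - apply (step_germ U_ultra), (ultra_all U_ultra). intros n. right. cbn. auto.
  - apply (step_germ U_ultra), (ultra_all U_ultra). intros n. left. cbn. auto.
  - apply reduct_of_node in Hy. destruct Hy as [k Hz].
    apply (ultra_False U_ultra).
    assert (E : U (fun n => (0, 0) = (n, S k) \/ ray_step (0, 0) (n, S k))).
    { apply (ultra_or U_ultra). destruct Hx as [z Hx|].
      - right. subst z. exact (proj1 (step_germ U_ultra rays _ _) Hx).
      - left. exact (proj1 (germ_eq U_ultra rays _ _) Hz). }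
    (* Index [0] must be excluded, since [(0, 0)] does step to [(0, 1)]. For [n >= 1], one step from
       [(0, 0)] stays in row [0] or ends at a position [0], so it misses [(n, S k)]. *)
    generalize (proj2 (ultra_and U_ultra _ _) (conj E (U_free 1))).
    apply (ultra_mono U_ultra). intros n [[Hn|Hn] Hle].
    + discriminate.
    + unfold ray_step in Hn. cbn in Hn. lia.
Qed.

End FreeUltrapower.

Theorem theorem3p19 :
  ~ generalised_first_order strongly_confluent /\
  ~ generalised_first_order (fun A : ars => ~ strongly_confluent A).
Proof.
  destruct free_ultrafilter_nat as [U [HU Hfree]].
  pose proof (ultrapower_rays_not_sc HU Hfree) as Hnot.
  split; intros [Phi HPhi].
  - apply Hnot, HPhi, (models_ultrapower HU), HPhi, rays_sc.
  (* For the negation the transfer runs back, from the ultrapower to [rays]. *)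
  - assert (H : ~ strongly_confluent rays); [|exact (H rays_sc)].
    apply HPhi, (models_ultrapower HU), HPhi, Hnot.
Qed.
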